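(* Let $E=\bigsqcup_{n\in\omega}E_n$ be a continuous signature and let $X$ be a semitopological $E$-algebra. If for every $n\in\mathrm{Sp}\,E$ the product $X^n$ is separately $\mathbb R$-factorizable over $E_n$, then the semitopological $E$-algebra $X$ is $\mathbb R$-factorizable.
   Context: All spaces are Tychonoff. A continuous signature is a space $E$ that is the disjoint union of clopen (possibly empty) subsets $E_n$, $n\in\omega=\{0,1,2,\dots\}$; $\mathrm{Sp}\,E=\{n\in\omega: E_n\ne\varnothing\}$. An $E$-algebra is a set $X$ with maps $\mathfrak e^X_n\colon E_n\times X^n\to X$, $n\in\omega$ ($X^0$ is a singleton). A semitopological $E$-algebra is an $E$-algebra endowed with a topology such that every $\mathfrak e^X_n$ is separately continuous, i.e. continuous in each of its $n+1$ arguments when the others are fixed. A homomorphism is a map commuting with all operations. A semitopological $E$-algebra $X$ is $\mathbb R$-factorizable if for every continuous $f\colon X\to\mathbb R$ there are a separable metrizable semitopological $E$-algebra $Y$, a continuous function $g\colon Y\to\mathbb R$ and a continuous homomorphism $h\colon X\to Y$ with $f=g\circ h$. For spaces $T,X_1,\dots,X_n$, the product $\prod_{i=1}^nX_i$ is separately $\mathbb R$-factorizable over $T$ if for every separately continuous function $f\colon T\times\prod_{i=1}^nX_i\to\mathbb R$ (continuous in each of the $n+1$ arguments) there are separable metrizable spaces $Y_1,\dots,Y_n$, continuous maps $h_i\colon X_i\to Y_i$, and a separately continuous function $g\colon T\times\prod_{i=1}^nY_i\to\mathbb R$ such that $f=g\circ(\mathrm{id}_T\times\prod_{i=1}^nh_i)$.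 *)

(* Defs.v *)
From HB Require Import structures.
From mathcomp Require Import all_boot all_order all_algebra.
From mathcomp Require Import all_classical all_reals all_analysis.

Set Implicit Arguments.
Unset Strict Implicit.
Unset Printing Implicit Defensive.

Import Order.TTheory GRing.Theory Num.Theory.
Import numFieldNormedType.Exports.

Local Open Scope classical_set_scope.

Definition tychonoff_space (T : topologicalType) : Prop :=
  completely_regular_space T /\ hausdorff_space T.

Definition separable_space (T : topologicalType) : Prop :=
  exists2 D : set T, countable D & dense D.

Definition metrizable_space (R : realType) (T : topologicalType) : Prop :=
  exists (M : metricType R) (f : T -> M) (g : M -> T),
    [/\ cancel f g, cancel g f, continuous f & continuous g].

(* Separable metrizable spaces are automatically Tychonoff, so the existential
   statements below do not repeat that requirement. *)
Definition separable_metrizable (R : realType) (T : topologicalType) : Prop :=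
  separable_space T /\ metrizable_space R T.

(* Maps on T * \prod_i X_i are curried.  [dfwith x i y] is the point x with its
   i-th coordinate replaced by y : X i. *)
Definition separately_continuous (T : topologicalType) (n : nat)
    (X : 'I_n -> topologicalType) (Z : topologicalType)
    (f : T -> (forall i, X i) -> Z) : Prop :=
  (forall x, continuous (fun t => f t x)) /\
  (forall t x i, continuous (fun y : X i => f t (dfwith x i y))).

Record signature := Signature {
  sig_space :> topologicalType;
  sig_part : nat -> set sig_space;
  sig_part_clopen : forall n, clopen (sig_part n);
  sig_part_disjoint : trivIset setT sig_part;
  sig_part_cover : \bigcup_n sig_part n = setT }.

Arguments sig_part : clear implicits.

Definition Sp (E : signature) : set nat := [set n | sig_part E n !=set0].

(* E_n is used as a type (coercion [set_type]), whose topology is the subspace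
   topology; the power X^n is the function type 'I_n -> X. *)
Definition algebra_ops (E : signature) (X : Type) : Type :=
  forall n, sig_part E n -> ('I_n -> X) -> X.

Definition homomorphism (E : signature) (X Y : Type) (eX : algebra_ops E X)
    (eY : algebra_ops E Y) (h : X -> Y) : Prop :=
  forall n (c : sig_part E n) (x : 'I_n -> X), h (eX n c x) = eY n c (h \o x).

Record semitop_algebra (E : signature) := SemitopAlgebra {
  alg_space :> topologicalType;
  alg_op : algebra_ops E alg_space;
  alg_op_continuous : forall n,
    @separately_continuous (sig_part E n) n (fun=> alg_space) alg_space
      (@alg_op n) }.

Arguments alg_op [E] _ _ _ _.

Definition R_factorizable (R : realType) (E : signature)
    (X : semitop_algebra E) : Prop :=
  forall f : X -> R, continuous f ->
  exists (Y : semitop_algebra E) (g : Y -> R) (h : X -> Y),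
    [/\ separable_metrizable R Y, continuous g, continuous h,
        homomorphism (alg_op X) (alg_op Y) h & f = g \o h].

Definition separately_R_factorizable (R : realType) (T : topologicalType)
    (n : nat) (X : 'I_n -> topologicalType) : Prop :=
  forall f : T -> (forall i, X i) -> R, separately_continuous f ->
  exists (Y : 'I_n -> topologicalType) (h : forall i, X i -> Y i)
         (g : T -> (forall i, Y i) -> R),
    [/\ forall i, separable_metrizable R (Y i),
        forall i, continuous (h i),
        separately_continuous g &
        forall t x, f t x = g t (fun i => h i (x i))].

(* Main.v *)
(* Close {f} to a countable family F of continuous functions on X such that, for
   every phi in F and every n, the maps h_i : X -> Y_i of a factorization of
   phi o e_n are continuous for the initial topology of F and factor through the
   points separated by F.  Such closure is possible because a map into a
   separable metrizable space is governed by countably many real functions, the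
   distances to the points of a dense sequence.  The image of X in R^F is then
   separable metrizable; the operations of X descend to it, and they are
   separately continuous there because each coordinate of e_n, as a function on
   the image, factors through separately continuous functions. *)
From HB Require Import structures.
Require Import Defs.
From mathcomp Require Import all_boot all_order all_algebra.
From mathcomp Require Import all_classical all_reals all_analysis.
From mathcomp Require Import lra.
Import Order.TTheory GRing.Theory Num.Theory.
Import numFieldNormedType.Exports.
Local Open Scope classical_set_scope.
Local Open Scope ring_scope.

Set Implicit Arguments.
Unset Strict Implicit.
Unset Printing Implicit Defensive.

Lemma ex_invn (R : realType) (e : R) : 0 < e -> exists N, N.+1%:R^-1 < e.
Proof.
move=> e0; have [N _ /(_ N (leqnn N))] := near_infty_natSinv_lt (PosNum e0).
by exists N.
Qed.

Lemma ex_rat_near (R : realType) (x e : R) :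
  0 < e -> exists r : rat, `|x - ratr r| < e.
Proof.
move=> e0; have [r] := @rat_in_itvoo R x (x + e) ltac:(lra).
rewrite in_itv /= => /andP[r1 r2]; exists r.
by rewrite ltr_distlC; apply/andP; split; lra.
Qed.

(** * The metric of a countable family of real functions *)

Section family_metric.
Context {R : realType} {Y : choiceType} (F : nat -> Y -> R).

(** Capping the [k]-th difference at [k.+1%:R^-1] leaves only finitely many indices relevant at a
    given precision, so the supremum metrizes the initial topology of [F] once [F] separates
    points. *)
Definition family_term (x y : Y) (k : nat) : R :=
  Num.min `|F k x - F k y| k.+1%:R^-1.

Definition family_dist (x y : Y) : R := sup (range (family_term x y)).

Lemma family_term_le_dist x y k : family_term x y k <= family_dist x y.
Proof.
apply: ub_le_sup; last by exists k.
exists 1 => _ [j _ <-]; rewrite /family_term ge_min; apply/orP; right.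
by rewrite invf_le1 // ler1n.
Qed.

Lemma family_dist_le x y e :
  (forall k, family_term x y k <= e) -> family_dist x y <= e.
Proof.
by move=> le_e; apply: ge_sup; [exists (family_term x y 0), 0|move=> _ [k _ <-]].
Qed.

Lemma family_dist_le_initial x y e N : N.+1%:R^-1 <= e ->
  (forall k, (k < N)%N -> `|F k x - F k y| <= e) -> family_dist x y <= e.
Proof.
move=> leN le_e; apply: family_dist_le => k; rewrite /family_term ge_min.
have [kN|Nk] := ltnP k N; first by rewrite le_e.
by apply/orP; right; apply: le_trans leN; rewrite lef_pV2 ?posrE // ler_nat.
Qed.

Lemma family_distxx x : family_dist x x = 0.
Proof.
have ge0 : 0 <= family_dist x x.
  apply: le_trans (family_term_le_dist x x 0).
  by rewrite /family_term subrr normr0 le_min lexx invr_ge0 ler0n.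
apply/eqP; rewrite eq_le ge0 andbT; apply: family_dist_le => k.
by rewrite /family_term subrr normr0 ge_min lexx.
Qed.

Lemma family_distC x y : family_dist x y = family_dist y x.
Proof.
rewrite /family_dist (_ : family_term x y = family_term y x) //.
by apply/funext => k; rewrite /family_term distrC.
Qed.

Lemma family_dist_triangle y x z :
  family_dist x z <= family_dist x y + family_dist y z.
Proof.
apply: family_dist_le => k.
apply: le_trans (lerD (family_term_le_dist x y k) (family_term_le_dist y z k)).
rewrite /family_term.
have w0 : 0 <= k.+1%:R^-1 :> R by [].
(* All three terms share the cap [w], and capping at a nonnegative constant preserves
   subadditivity. *)
have := ler_distD (F k y) (F k x) (F k z).
move: (normr_ge0 (F k x - F k y)) (normr_ge0 (F k y - F k z)).
move: `|F k x - F k z| `|F k x - F k y| `|F k y - F k z| w0.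
move: (k.+1%:R^-1) => w a b c w0 b0 c0 abc.
by rewrite ge_min; case: (leP b w) => ?; case: (leP c w) => ?;
  apply/orP; ((left; lra) || (right; lra)).
Qed.

Lemma family_dist_lt x y e k :
  e <= k.+1%:R^-1 -> family_dist x y < e -> `|F k x - F k y| < e.
Proof.
move=> ek /(le_lt_trans (family_term_le_dist x y k)).
by rewrite /family_term gt_min => /orP[//|]; rewrite ltNge ek.
Qed.

Lemma family_dist_eq0 : injective (fun y => F^~ y) ->
  forall x y, family_dist x y = 0 -> x = y.
Proof.
move=> injF x y xy0; apply: injF; apply/funext => k.
apply/eqP; rewrite -subr_eq0 -normr_le0.
have := family_term_le_dist x y k; rewrite xy0 /family_term ge_min => /orP[//|].
by rewrite invr_le0 // lern0.
Qed.

End family_metric.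

(* An alias of [Y], so that the metric below does not clash with any topology
   already present on [Y]. *)
Definition family_space (R : realType) (Y : choiceType) (F : nat -> Y -> R)
  (injF : injective (fun y => F^~ y)) : Type := Y.

Section family_space.
Context {R : realType} {Y : choiceType} (F : nat -> Y -> R).
Variable injF : injective (fun y => F^~ y).
Local Notation M := (family_space injF).

HB.instance Definition _ := Choice.copy M Y.
HB.instance Definition _ := @isMetric.Build R M (family_dist F)
  (family_distxx F) (family_dist_eq0 injF) (family_distC F)
  (family_dist_triangle F).

Lemma family_space_ball (x : M) (e : R) :
  ball x e = [set y | family_dist F x y < e].
Proof. by rewrite ballEmdist. Qed.

Lemma family_space_continuous k : continuous (F k : M -> R).
Proof.
move=> x; have nbhs_x_filter := nbhs_filter x.
apply/cvgrPdist_lt => e e0.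
(* Below the cap [k.+1%:R^-1], a bound on the distance bounds the [k]-th difference itself. *)
pose d := Num.min e k.+1%:R^-1.
have d0 : 0 < d by rewrite /d lt_min e0 invr_gt0 ltr0n.
have : \forall y \near x, ball x d y by exact: (nbhsx_ballx x d d0).
apply: filterS => y; rewrite family_space_ball /= => /family_dist_lt -/(_ k).
rewrite /d ge_min lexx orbT.
by move=> /(_ isT); rewrite lt_min => /andP[].
Qed.

Lemma continuous_to_family_space (Z : topologicalType) (g : Z -> M) :
  (forall k, continuous (fun z => F k (g z))) -> continuous g.
Proof.
move=> Fg z; apply/(@cvg_ballP R) => e e0.
have e20 : 0 < e / 2 by rewrite divr_gt0.
(* From [N] on the cap keeps every term below [e / 2], so only finitely many neighbourhoods need
   intersecting. *)
have [N Ne] := ex_invn e20.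
have : \forall y \near z, forall k : 'I_N, `|F k (g z) - F k (g y)| < e / 2.
  by apply: filter_forall => k; move: (Fg k z) => /cvgrPdist_lt /(_ _ e20).
apply: filterS => y le_e; rewrite family_space_ball /=.
apply: (@le_lt_trans _ _ (e / 2)); last by lra.
apply: family_dist_le_initial (ltW Ne) _ => k kN.
exact: ltW (le_e (Ordinal kN)).
Qed.

Lemma family_space_separable : separable_space M.
Proof.
(* [B s] fixes the first [size s] coordinates approximately; one point from each nonempty [B s]
   gives a countable dense set. *)
pose B (s : seq rat) : set M := [set y | forall k, (k < size s)%N ->
  `|F k y - ratr s`_k| < (size s).+1%:R^-1].
have [p pP] : {p : {s : seq rat | `[< B s !=set0 >]} -> M &
    forall s, B (val s) (p s)}.
  apply: (@choice _ _ (fun s y => B (val s) y)) => -[s /= /asboolP[y By]].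
  by exists y.
exists (range p); first exact: card_le_trans (card_image_le _ _) (countableP _).
move=> O [y Oy] oO.
have /(@nbhs_ballP R)[e /= e0 yeO] : nbhs y O by exact: open_nbhs_nbhs.
(* At each index below [N], [y] and the chosen point both come within [e / 4] of the same
   rational. *)
have e40 : 0 < e / 4 by lra.
have [N Ne] := ex_invn e40.
have [q qP] : {q : nat -> rat &
    forall k, `|F k y - ratr (q k)| < N.+1%:R^-1}.
  apply: (@choice _ _ (fun k r => `|F k y - ratr r| < N.+1%:R^-1)) => k.
  by apply: ex_rat_near; rewrite invr_gt0 ltr0n.
have By : B (mkseq q N) y.
  by move=> k; rewrite size_mkseq => kN; rewrite nth_mkseq.
have Bs : `[< B (mkseq q N) !=set0 >] by apply/asboolP; exists y.
pose t : {s : seq rat | `[< B s !=set0 >]} := Sub (mkseq q N) Bs.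
exists (p t); split; last by exists t.
apply: yeO; rewrite family_space_ball /=.
apply: (@le_lt_trans _ _ (e / 2)); last by lra.
apply: (@family_dist_le_initial _ _ _ _ _ _ N).
  by apply: le_trans (ltW Ne) _; lra.
move=> k kN; have := pP t k; rewrite /= size_mkseq => /(_ kN).
rewrite nth_mkseq // => pk; apply: le_trans (ler_distD (ratr (q k)) _ _) _.
rewrite [in X in _ + X]distrC (@splitr _ (e / 2)) lerD // ltW //.
  by apply: lt_le_trans (lt_trans (qP k) Ne) _; lra.
by apply: lt_le_trans (lt_trans pk Ne) _; lra.
Qed.

Lemma family_space_separable_metrizable : separable_metrizable R M.
Proof.
split; first exact: family_space_separable.
by exists M, id, id; split => // x; exact: cvg_id.
Qed.

End family_space.

(** * Maps governed by countably many real functions *)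

(* Quantifying over [s : Z -> X] says that [h] is continuous for the initial
   topology of [psi] without introducing a second topology on [X]; in the proof
   of the theorem [s] is a section, in general discontinuous, of the quotient
   map onto the factor algebra. *)
Definition controls (R : realType) (X Y : topologicalType) (A : Type)
    (psi : A -> X -> R) (h : X -> Y) : Prop :=
  (forall x x', (forall a, psi a x = psi a x') -> h x = h x') /\
  (forall (Z : topologicalType) (s : Z -> X),
     (forall a, continuous (psi a \o s)) -> continuous (h \o s)).

Lemma dense_seq_controls (R : realType) (X Y : topologicalType) (h : X -> Y) :
  separable_metrizable R Y -> continuous h ->
  exists psi : nat -> X -> R, (forall j, continuous (psi j)) /\ controls psi h.
Proof.
move=> [[D cD dD] [M [u [v [uK vK cu cv]]]]] ch.
have near_D y e : 0 < e -> exists2 q, D q & mdist (u y) (u q) < e.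
  move=> e0; have /(_ _)[] := dD (u @^-1` (ball (u y) e)^°).
  - by exists y; rewrite /= /interior; exact: nbhsx_ballx.
  - by apply: open_comp (@open_interior _ _) => ? _; exact: cu.
  by move=> q [/interior_subset]; rewrite ballEmdist => ? ?; exists q.
(* If the dense set is empty then so is [X], and any family works. *)
have [D0|[q]] := (pfcard_geP cD).
  exists (fun _ _ => 0); split; first by move=> _ x; exact: cvg_cst.
  split=> [x|Z s _ z].
    by have [q] := near_D (h x) 1 ltr01; rewrite D0.
  by have [q] := near_D (h (s z)) 1 ltr01; rewrite D0.
have {}near_D y e : 0 < e -> exists j, mdist (u y) (u (q j)) < e.
  move=> /(near_D y)[p Dp]; have [j _ <-] := (@surj _ _ _ _ q _ Dp).
  by exists j.
exists (fun j x => mdist (u (h x)) (u (q j))); split=> [j|].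
  move=> x; apply/cvgrPdist_lt => e e0.
  have : u (h y) @[y --> x] --> u (h x).
    by apply: continuous_comp; [exact: ch|exact: cu].
  move=> /cvg_ball /(_ _ e0); apply: filterS => y.
  rewrite ballEmdist /= => xy.
  have := metric_triangle (u (h x)) (u (h y)) (u (q j)).
  have := metric_triangle (u (h y)) (u (h x)) (u (q j)).
  rewrite (metric_sym (u (h y)) (u (h x))) ltr_distlC => ? ?.
  by apply/andP; split; lra.
split=> [x x' xx'|Z s cs z].
  apply: (can_inj uK); apply: mdist_positivity.
  apply/eqP; rewrite eq_le mdist_ge0 andbT; apply/ler_addgt0Pl => e e0.
  have [j xj] := near_D (h x) (e / 2) ltac:(lra).
  have := metric_triangle (u (h x)) (u (q j)) (u (h x')).
  by rewrite (metric_sym (u (q j))) -xx'; lra.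
rewrite (_ : h \o s = v \o (u \o h \o s)); last first.
  by apply/funext => y /=; rewrite uK.
apply: continuous_comp; last exact: cv.
apply/(@cvg_ballP R) => e e0.
(* [q j] is within [e / 3] of the value at [z], hence within [2 e / 3] of the value at any [y] near
   [z]. *)
have e3 : 0 < e / 3 by lra.
have [j zj] := near_D (h (s z)) (e / 3) e3.
have /cvgrPdist_lt /(_ _ e3) := cs j z; apply: filterS => y /=.
rewrite ballEmdist /= ltr_distlC => /andP[_ yj].
have := metric_triangle (u (h (s z))) (u (q j)) (u (h (s y))).
by rewrite (metric_sym (u (q j))); lra.
Qed.

(** Counterpart of [controls] for [phi] after the [n]-th operation. The first clause serves
    independence of representatives, the second separate continuity on the image of [X]. *)
Definition operation_controlled (R : realType) (E : signature)
    (X : semitop_algebra E) (n : nat) (A : Type) (psi : A -> X -> R)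
    (phi : X -> R) : Prop :=
  (forall (c : sig_part E n) (x x' : 'I_n -> X),
    (forall a i, psi a (x i) = psi a (x' i)) ->
    phi (alg_op X n c x) = phi (alg_op X n c x')) /\
  (forall (Z : topologicalType) (s : Z -> X),
    (forall a, continuous (psi a \o s)) ->
    @separately_continuous (sig_part E n) n (fun=> Z) R
      (fun c z => phi (alg_op X n c (s \o z)))).

Lemma operation_controlled_factor (R : realType) (E : signature)
    (X : semitop_algebra E) (n : nat) (phi : X -> R) :
  (Sp E n -> @separately_R_factorizable R (sig_part E n) n (fun=> X)) ->
  continuous phi ->
  exists psi : 'I_n * nat -> X -> R,
    (forall a, continuous (psi a)) /\ operation_controlled n psi phi.
Proof.
move=> factX cphi.
(* When [sig_part E n] is empty there is no factorization to use, but also no [c] to check. *)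
have [spn|nspn] := pselect (Sp E n); last first.
  have noc (c : sig_part E n) : False.
    by apply: nspn; exists (val c); exact: set_valP.
  exists (fun _ _ => 0); split; first by move=> _ x; exact: cvg_cst.
  split=> [c|Z s _]; first by case: (noc c).
  by split=> [z c|c]; case: (noc c).
have [opT opX] := @alg_op_continuous E X n.
have [|Y [h [g [smY ch [gT gX] fE]]]] :=
    factX spn (fun c x => phi (alg_op X n c x)).
  split=> [x c|c x i y]; apply: continuous_comp; try exact: cphi.
    exact: opT.
  exact: opX.
have [psi psiP] := choice (fun i => dense_seq_controls (smY i) (ch i)).
exists (fun a => psi a.1 a.2); split=> [a|]; first exact: (psiP a.1).1.
split=> [c x x' xx'|Z s cs].
  rewrite !fE; congr (g c _); apply: functional_extensionality_dep => i.
  by apply: (psiP i).2.1 => j; exact: (xx' (i, j)).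
split=> [z c|c z i y].
  by apply: continuous_comp; [exact: opT|exact: cphi].
have hs : continuous (h i \o s).
  by apply: (psiP i).2.2 => j; exact: (cs (i, j)).
(* [s] may be discontinuous; the slice is continuous because it is a slice of [g] after
   [h i \o s]. *)
rewrite (_ : (fun y => _) =
    (fun y => g c (dfwith (fun j => h j (s (z j))) i y)) \o (h i \o s)).
  by apply: continuous_comp; [exact: hs|exact: gX].
apply/funext => w /=; rewrite fE; congr (g c _).
apply: functional_extensionality_dep => j /=.
by have [<-|ij] := eqVneq i j; [rewrite !dfwithin|rewrite !dfwithout].
Qed.

(** * Closing up to a countable controlled family *)

Lemma ex_controlled_sequence (R : realType) (E : signature)
    (X : semitop_algebra E) (f : X -> R) :
  (forall n, Sp E n -> @separately_R_factorizable R (sig_part E n) n (fun=> X)) ->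
  continuous f ->
  exists F : nat -> X -> R,
    [/\ forall k, continuous (F k), exists k, F k = f &
        forall n k, operation_controlled n F (F k)].
Proof.
move=> factX cf.
pose C := {phi : X -> R & continuous phi}.
pose J := {n & 'I_n * nat}%type.
have GE (phi : C) n : exists G : 'I_n * nat -> C,
    operation_controlled n (fun a => projT1 (G a)) (projT1 phi).
  have [psi [cpsi psiP]] :=
    operation_controlled_factor (factX n) (projT2 phi).
  by exists (fun a => existT _ (psi a) (cpsi a)).
pose G phi n := projT1 (cid (GE phi n)).
have GP phi n : operation_controlled n (fun a => projT1 (G phi n a)) (projT1 phi).
  exact: projT2 (cid (GE phi n)).
(* Words over the countable type [J] index the closure: the letter [(n, a)] in front of [l] gives
   the [a]-th function controlling [K l] for the [n]-th operation. *)
pose fix K (l : seq J) : C :=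
  if l is i :: l' then G (K l') (projT1 i) (projT2 i) else existT _ f cf.
(* Numbers that code no word are sent to the empty word, that is, to [f]. *)
pose F k := projT1 (K (odflt [::] (unpickle k))).
have FE (l : seq J) : F (pickle l) = projT1 (K l) by rewrite /F pickleK.
exists F; split=> [k||n k]; first exact: projT2 (K _).
  by exists (pickle ([::] : seq J)); rewrite FE.
have [l ->] : exists l, F k = projT1 (K l) by exists (odflt [::] (unpickle k)).
have KF a : F (pickle ((existT _ n a : J) :: l)) = projT1 (G (K l) n a).
  by rewrite FE.
have [sep cont] := GP (K l) n.
split=> [c x x' xx'|Z s cs].
  by apply: sep => a i; rewrite -KF; exact: xx'.
by apply: cont => a; rewrite -KF; exact: cs.
Qed.

(** * The algebra structure on the image of [X] *)

Section image_algebra.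
Context {R : realType} {E : signature} {X : semitop_algebra E}.
Variable F : nat -> X -> R.
Hypothesis F_continuous : forall k, continuous (F k).
Hypothesis F_controlled : forall n k, operation_controlled n F (F k).

Let H (x : X) : nat -> R := F^~ x.

Let coord (k : nat) (y : range H) : R := val y k.

Let coord_inj : injective (fun y => coord^~ y).
Proof. by move=> y y' yy'; apply: val_inj. Qed.

Let Y := family_space coord_inj.

Let h (x : X) : Y := SigSub (mem_set (ex_intro2 _ _ x I (erefl (H x)))).

Let section_ex (y : Y) : exists x, h x = y.
Proof.
case: y => y /= yH; have [x _ xy] := set_mem yH.
by exists x; apply: val_inj.
Qed.

Let s (y : Y) : X := projT1 (cid (section_ex y)).

Let sK : cancel s h. Proof. by move=> y; exact: projT2 (cid (section_ex y)). Qed.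

Let F_s k y : F k (s y) = coord k y. Proof. by rewrite -[in RHS](sK y). Qed.

(** Arguments are lifted by an arbitrary section; that the choice of lift does not matter is what
    makes [h] a homomorphism. *)
Let op : algebra_ops E Y := fun n c y => h (alg_op X n c (s \o y)).

Let F_s_continuous k : continuous (F k \o s).
Proof.
rewrite (_ : _ \o _ = coord k); first exact: family_space_continuous.
by apply/funext => y; exact: F_s.
Qed.

Let op_continuous n :
  @separately_continuous (sig_part E n) n (fun=> Y) Y (@op n).
Proof.
split=> [y|c y i]; apply: continuous_to_family_space => k.
  by have [+ _] := (F_controlled n k).2 Y s F_s_continuous; apply.
by have [_ +] := (F_controlled n k).2 Y s F_s_continuous; apply.
Qed.

Let A : semitop_algebra E := SemitopAlgebra op_continuous.

Lemma controlled_sequence_factors k :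
  exists (A : semitop_algebra E) (g : A -> R) (h : X -> A),
    [/\ separable_metrizable R A, continuous g, continuous h,
        homomorphism (alg_op X) (alg_op A) h & F k = g \o h].
Proof.
exists A, (coord k), h; split=> //.
- exact: family_space_separable_metrizable.
- exact: family_space_continuous.
- by apply: continuous_to_family_space => j; exact: F_continuous.
move=> n c x; apply: val_inj; apply/funext => j /=.
(* [x i] and [s (h (x i))] agree under every [F a], so [F j] after the operation cannot tell them
   apart. *)
apply: (F_controlled n j).1 => a i /=.
by rewrite F_s.
Qed.

End image_algebra.

Theorem theorem13 (R : realType) (E : signature) (X : semitop_algebra E)
    (tychE : tychonoff_space E) (tychX : tychonoff_space X)
    (factX : forall n : nat, Sp E n ->
      @separately_R_factorizable R (sig_part E n) n (fun=> X)) :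
  R_factorizable R X.
Proof.
move=> f cf.
have [F [cF [k <-] FP]] := ex_controlled_sequence factX cf.
exact: controlled_sequence_factors.
Qed.
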